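(* Let $N\ge 1$, let $\mathcal{H}=(\mathbb{C}^2)^{\otimes N}$, $G=\sum_{n=1}^N \hat X_n$ and $S(x)=e^{-ixG/2}$ for $x\in\mathbb{R}$. For $\omega\in\{1,\dots,N\}$ let $\{(\mathcal{X}_{\omega,r},\mathcal{Y}_{\omega,r})\}_{r=1}^{d_\omega}$ be the invariant pairs at frequency $\omega$ (defined in the context), and let $m_{\omega,r}=|S_+^{(r)}|+|S_-^{(r)}|$ be the number of active qubits of the $r$-th pair. Then the operators $\mathcal{X}_{\omega,r},\mathcal{Y}_{\omega,r}$ ($1\le\omega\le N$, $1\le r\le d_\omega$) are mutually orthogonal with $$\langle\mathcal{X}_{\omega,r},\mathcal{X}_{\omega,r}\rangle=\langle\mathcal{Y}_{\omega,r},\mathcal{Y}_{\omega,r}\rangle=2^{\,m_{\omega,r}+1},$$ and together with the commutant $\mathcal{B}_0$ they span $\mathcal{B}(\mathcal{H})$. Consequently, for every state $\rho$ and every observable $O$ on $\mathcal{H}$, the function $f(x)=\mathrm{Tr}\bigl(\rho\,S(x)^\dagger O\,S(x)\bigr)$ satisfies, for all $x\in\mathbb{R}$, $$f(x)=\mathrm{Tr}\bigl(\rho\,\Pi_0 O\bigr)+\sum_{\omega=1}^{N}\sum_{r=1}^{d_\omega} f_{\omega,r}(x),$$ where $\Pi_0$ is the orthogonal projection of $\mathcal{B}(\mathcal{H})$ onto $\mathcal{B}_0$ and $$f_{\omega,r}(x)=2^{\,N-m_{\omega,r}-1}\begin{bmatrix}\langle\rho,\mathcal{X}_{\omega,r}\rangle\\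 \langle\rho,\mathcal{Y}_{\omega,r}\rangle\end{bmatrix}^{\top}\begin{bmatrix}\cos(\omega x)&-\sin(\omega x)\\ \sin(\omega x)&\cos(\omega x)\end{bmatrix}\begin{bmatrix}\langle O,\mathcal{X}_{\omega,r}\rangle\\ \langle O,\mathcal{Y}_{\omega,r}\rangle\end{bmatrix}.$$
   Context: $\mathcal{B}(\mathcal{H})$ is the space of all linear operators on $\mathcal{H}=(\mathbb{C}^2)^{\otimes N}$, with inner product $\langle A,B\rangle=2^{-N}\mathrm{Tr}(A^\dagger B)$. $X,Y,Z$ are the Pauli matrices, and for a single-qubit operator $A$, $\hat A_n=I^{\otimes(n-1)}\otimes A\otimes I^{\otimes(N-n)}$. A state is a positive semidefinite operator of trace 1; an observable is a Hermitian operator. Put $E_j^{\pm}=\hat Z_j\pm i\hat Y_j$. A configuration is a triple $c=(S_+,S_-,T)$ of pairwise disjoint (possibly empty) subsets of $\{1,\dots,N\}$; define $$E_c=\prod_{j\in S_+}E_j^+\prod_{j\in S_-}E_j^-\prod_{j\in T}\hat X_j,\qquad \omega(c)=|S_+|-|S_-|.$$ For $\omega\ge1$, $d_\omega$ is the number of configurations $c$ with $\omega(c)=\omega$; these are enumerated as $(S_+^{(r)},S_-^{(r)},T^{(r)})$, $r=1,\dots,d_\omega$. Writing $E_{\omega,r}$ for the corresponding $E_c$, the $r$-th invariant pair at frequency $\omega$ is $\mathcal{X}_{\omega,r}=E_{\omega,r}+E_{\omega,r}^\dagger$, $\mathcal{Y}_{\omega,r}=\frac1i(E_{\omega,r}-E_{\omega,r}^\dagger)$.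 The commutant is $\mathcal{B}_0=\{A\in\mathcal{B}(\mathcal{H}):[G,A]=0\}$. *)

(* Defs.v *)
From HB Require Import structures.
From mathcomp Require Import all_boot all_order all_algebra.
From mathcomp Require Import complex.
From mathcomp Require mxtens.
From mathcomp Require Import all_classical all_reals all_analysis.

Set Implicit Arguments.
Unset Strict Implicit.
Unset Printing Implicit Defensive.

Import Order.TTheory GRing.Theory Num.Theory.
Import numFieldNormedType.Exports.
Local Open Scope classical_set_scope.
Local Open Scope sesquilinear_scope.
Local Open Scope ring_scope.

(* The operators on (C^2)^{\otimes N} are the matrices 'M[R[i]]_(2 ^ N), in the
   basis of tensor products of the standard basis vectors of C^2, ordered as in
   the Kronecker product tensmx.  The qubits 1..N are the elements 0..N-1 of
   'I_N; the frequencies keep their values 1..N. *)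
Notation op R N := 'M[R[i]]_(2 ^ N).

Section Matrices.
Variable R : realType.
Local Notation C := R[i].

Definition expmx n (A : 'M[C]_n) : 'M[C]_n :=
  limn (series (fun k => (k`!%:R)^-1 *: A ^+ k)).

Definition commutator n (A B : 'M[C]_n) : 'M[C]_n := A * B - B * A.

(* On R[i], 0 <= z means that z is real and nonnegative. *)
Definition psd n (A : 'M[C]_n) : Prop :=
  A \is hermsymmx /\ forall v : 'cV[C]_n, 0 <= (v ^t* *m A *m v) 0 0.

Definition mx2 (a b c d : C) : 'M[C]_2 :=
  \matrix_(i, j) if i == 0 then (if j == 0 then a else b)
                 else (if j == 0 then c else d).

Definition col2 (a b : C) : 'cV[C]_2 := \col_i (if i == 0 then a else b).

Definition pauliX : 'M[C]_2 := mx2 0 1 1 0.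
Definition pauliY : 'M[C]_2 := mx2 0 (- 'i) 'i 0.
Definition pauliZ : 'M[C]_2 := mx2 1 0 0 (- 1).

End Matrices.

Lemma dim_site N (n : 'I_N) : (2 ^ n * 2 * 2 ^ (N - n.+1) = 2 ^ N)%N.
Proof. by rewrite -expnSr -expnD subnKC. Qed.

Section Operators.
Variables (R : realType) (N : nat).
Local Notation C := R[i].
Local Notation op := (op R N).

Definition inner (A B : op) : C := 2 ^- N * \tr (A ^t* * B).

Definition is_state (rho : op) : Prop := psd rho /\ \tr rho = 1.

Definition is_observable (O : op) : Prop := O \is hermsymmx.

(* I^{\otimes n} \otimes A \otimes I^{\otimes (N - n - 1)}; the cast only
   identifies the dimensions 2 ^ n * 2 * 2 ^ (N - n.+1) and 2 ^ N. *)
Definition site (A : 'M[C]_2) (n : 'I_N) : op :=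
  castmx (dim_site n, dim_site n)
    (mxtens.tensmx (mxtens.tensmx (1%:M : 'M[C]_(2 ^ n)) A)
            (1%:M : 'M[C]_(2 ^ (N - n.+1)))).

Definition G : op := \sum_(n < N) site (pauliX R) n.

Definition evol (x : R) : op := expmx (- ('i * x%:C%C / 2) *: G).

Definition Eplus (j : 'I_N) : op := site (pauliZ R) j + 'i *: site (pauliY R) j.
Definition Eminus (j : 'I_N) : op := site (pauliZ R) j - 'i *: site (pauliY R) j.

End Operators.

Section Configurations.
Variable N : nat.

(* (S_+, S_-, T) is ((S_+, S_-), T). *)
Definition triple : finType := ({set 'I_N} * {set 'I_N} * {set 'I_N})%type.

Definition splus (c : triple) : {set 'I_N} := c.1.1.
Definition sminus (c : triple) : {set 'I_N} := c.1.2.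
Definition tset (c : triple) : {set 'I_N} := c.2.

Definition is_config (c : triple) : bool :=
  [&& [disjoint splus c & sminus c], [disjoint splus c & tset c]
    & [disjoint sminus c & tset c]].

Definition freq (c : triple) : int := #|splus c|%:Z - #|sminus c|%:Z.

Definition active (c : triple) : nat := #|splus c| + #|sminus c|.

Definition configs (w : nat) : {set triple} :=
  [set c | is_config c && (freq c == w%:Z)].

Definition nconf (w : nat) : nat := #|configs w|.

(* For each frequency w = 1..N, the sequence (c w r)_(r < nconf w) lists every
   configuration of frequency w exactly once. *)
Definition enumerates (c : forall w, 'I_(nconf w) -> triple) : Prop :=
  forall w, (1 <= w <= N)%N -> perm_eq (codom (c w)) (enum (configs w)).

End Configurations.

Section Pairs.
Variables (R : realType) (N : nat).
Local Notation C := R[i].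
Local Notation op := (op R N).

(* Factors on distinct qubits commute, so that the order of the
   factors (the increasing one on 'I_N) is irrelevant. *)
Definition Econf (c : triple N) : op :=
  (\prod_(j in splus c) Eplus R j) * (\prod_(j in sminus c) Eminus R j)
  * (\prod_(j in tset c) site (pauliX R) j).

Definition Xpair (c : triple N) : op := Econf c + (Econf c) ^t*.
Definition Ypair (c : triple N) : op := 'i^-1 *: (Econf c - (Econf c) ^t*).

Definition commutant : set op := [set A | commutator (G R N) A = 0].

(* Orthogonal projection onto a subspace V: the element P of V such that A - P
   is orthogonal to V (unique since inner is positive definite, and
   existing since the dimension is finite; 0 is only the default of xget). *)
Definition orth_proj (V : set op) (A : op) : op :=
  xget 0 [set P | V P /\ forall B, V B -> inner B (A - P) = 0].

Definition Pi0 (A : op) : op := orth_proj commutant A.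

Definition expect (rho O : op) (x : R) : C :=
  \tr (rho * ((evol N x) ^t* * O * evol N x)).

Definition rotation (t : R) : 'M[C]_2 :=
  mx2 (cos t)%:C%C (- sin t)%:C%C (sin t)%:C%C (cos t)%:C%C.

(* The exponent N - m - 1 is an integer, equal to -1 when m = N. *)
Definition fcomp (rho O : op) (w : nat) (c : triple N) (x : R) : C :=
  2 ^ (N%:Z - (active c)%:Z - 1) *
  ((col2 (inner rho (Xpair c)) (inner rho (Ypair c)))^T
   *m rotation (w%:R * x)
   *m col2 (inner O (Xpair c)) (inner O (Ypair c))) 0 0.

End Pairs.

(* Main.v *)
(* Write W_f for the tensor product of the letters f_j in {E^+, E^-, X, I}.  The
   letters are an orthogonal basis of the 2x2 matrices, hence the 4^N words W_f are
   an orthogonal basis of B(H); the adjoint exchanges the letters E^+ and E^-.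
   Since [X, E^+] = -2 E^+ and [X, E^-] = 2 E^-, one gets [G, W_f] = -2 omega(f) W_f.
   Diagonalizing the Hermitian G turns this into S(x)^* W_f S(x) = e^{-i omega(f) x} W_f.
   Expanding O on the words, the words of frequency 0 span the commutant and give
   Pi_0 O, and each word of frequency omega > 0 together with its adjoint gives one
   rotated pair. *)
Require Import Defs.
From HB Require Import structures.
From mathcomp Require Import all_boot all_order all_algebra.
From mathcomp Require Import complex.
From mathcomp Require Import all_classical all_reals all_analysis.
From mathcomp Require mxtens.
From mathcomp Require Import zify ring.

Set Implicit Arguments.
Unset Strict Implicit.
Unset Printing Implicit Defensive.

Import Order.TTheory GRing.Theory Num.Theory.
Import numFieldNormedType.Exports.
Local Open Scope classical_set_scope.
Local Open Scope ring_scope.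
Local Open Scope sesquilinear_scope.

(** * Exponential of a Hermitian matrix *)

Section UnitaryConjugation.
Variables (C : numClosedFieldType) (n : nat).
Implicit Types (P : 'M[C]_n) (d : 'rV[C]_n).

Lemma unitary_diag_exp P d k : P \is unitarymx ->
  (P ^t* *m diag_mx d *m P) ^+ k = P ^t* *m diag_mx (\row_j d 0 j ^+ k) *m P.
Proof.
move=> PU; elim: k => [|k IHk].
  rewrite expr0 (_ : \row_j _ = const_mx 1) ?diag_const_mx; last first.
    by apply/rowP => j; rewrite !mxE expr0.
  by rewrite mulmx1 -invmx_unitary // mulVmx ?unitarymx_unit.
rewrite exprS IHk -[LHS]/(_ *m _) !mulmxA mulmxtVK // -(mulmxA (P ^t*)).
rewrite mulmx_diag; congr (_ *m diag_mx _ *m _).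
by apply/rowP => j; rewrite !mxE exprS.
Qed.

Lemma diag_mx_sum_delta d : diag_mx d = \sum_i d 0 i *: delta_mx i i.
Proof.
apply/matrixP => j k; rewrite !mxE summxE (bigD1 j) //= !mxE eqxx /=.
rewrite eq_sym big1 ?addr0 => [|i ij]; first by rewrite mulr_natr.
by rewrite !mxE eq_sym (negPf ij) mulr0.
Qed.

(** The matrices on the right do not depend on d, so limits in d can be taken coefficient by
    coefficient; this is how the exponential series is summed. *)
Lemma conj_diag_sum P d : P ^t* *m diag_mx d *m P
  = \sum_j d 0 j *: (P ^t* *m delta_mx j j *m P).
Proof.
rewrite diag_mx_sum_delta mulmx_sumr mulmx_suml; apply: eq_bigr => j _.
by rewrite -scalemxAr -scalemxAl.
Qed.

Lemma conj_diagZ (c : C) P d :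
  c *: (P ^t* *m diag_mx d *m P) = P ^t* *m diag_mx (c *: d) *m P.
Proof. by rewrite linearZ /= -scalemxAr -scalemxAl. Qed.

(** In the basis where A is diagonal, the commutator relation reads (d_j - d_k) F_jk = c F_jk. It
    kills every entry outside the pairs with d_j - d_k = c, and on those pairs conjugation by U
    multiplies by the constant e. *)
Lemma unitary_conj_eigenvector P d (v : 'rV[C]_n) (E : 'M[C]_n) (c e : C) :
    P \is unitarymx ->
    (forall j k, d 0 j - d 0 k = c -> (v 0 j)^* * v 0 k = e) ->
  let A := P ^t* *m diag_mx d *m P in
  let U := P ^t* *m diag_mx v *m P in
  A *m E - E *m A = c *: E -> U ^t* *m E *m U = e *: E.
Proof.
move=> PU dv A U AE.
have [F FE] : exists F, F = P *m E *m P ^t* by exists (P *m E *m P ^t*).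
have PP : P *m P ^t* = 1%:M by exact/unitarymxP.
have P'P : P ^t* *m P = 1%:M.
  by rewrite -invmx_unitary // mulVmx ?unitarymx_unit.
have EE : E = P ^t* *m F *m P.
  by rewrite FE !mulmxA P'P mul1mx -mulmxA P'P mulmx1.
have PAP (d' : 'rV[C]_n) : P *m (P ^t* *m diag_mx d' *m P) = diag_mx d' *m P.
  by rewrite !mulmxA PP mul1mx.
have DF : diag_mx d *m F - F *m diag_mx d = c *: F.
  have -> : c *: F = P *m (A *m E - E *m A) *m P ^t*.
    by rewrite AE -scalemxAr -scalemxAl FE.
  rewrite mulmxBr mulmxBl; congr (_ - _).
    by rewrite (mulmxA P) [P *m A]PAP FE !mulmxA.
  by rewrite FE /A !mulmxA -(mulmxA _ P) PP mulmx1.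
have VFV : (diag_mx v) ^t* *m F *m diag_mx v = e *: F.
  apply/matrixP => j k; rewrite mul_mx_diag mxE.
  rewrite tr_diag_mx map_diag_mx mul_diag_mx !mxE.
  have /matrixP/(_ j k) := DF; rewrite mul_mx_diag mul_diag_mx !mxE => DFjk.
  have [->|Fjk] := eqVneq (F j k) 0; first by rewrite !(mulr0, mul0r).
  by rewrite mulrAC -(dv j k) //; apply: (mulIf Fjk); rewrite -DFjk; ring.
rewrite [in LHS]EE {1}/U !trmx_mul !map_mxM trmxCK /U !mulmxA.
rewrite -[_ *m P *m P ^t*]mulmxA PP mulmx1.
rewrite -[_ *m P *m P ^t*]mulmxA PP mulmx1.
by rewrite [in RHS]EE scalemxAl scalemxAr -VFV !mulmxA.
Qed.

End UnitaryConjugation.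

(** * The scalar series of e^{it} and the exponential of a diagonalized matrix *)

Section Cis.
Variable R : realType.
Local Notation C := R[i].
Local Notation K := (C : numFieldType).
Implicit Types a b t : R.

Definition cis t : C := (cos t)%:C%C + 'i * (sin t)%:C%C.

Lemma conj_real_complex a : (a%:C%C)^* = a%:C%C :> C.
Proof. by apply/CrealP/complex_realP; exists a. Qed.

Lemma cisN t : cis (- t) = (cis t)^*.
Proof.
rewrite /cis cosN sinN rmorphD rmorphM /= conjCi !conj_real_complex.
by rewrite rmorphN mulrN mulNr.
Qed.

Lemma cisD a b : cis (a + b) = cis a * cis b.
Proof.
rewrite /cis cosD sinD !(rmorphB, rmorphD, rmorphM) /=.
have := @sqrCi C; rewrite expr2 => ii.
by ring: ii.
Qed.

Lemma real_complex_continuous : continuous (fun a : R => a%:C%C : K).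
Proof.
move=> a; apply/cvgrPdist_lt => e e0.
(* A positive element of C is real, so the radius can be taken in R. *)
have [e' ee] : exists r : R, e = r%:C%C.
  by apply/complex_realP; rewrite ger0_real // ltW.
move: e0; rewrite {}ee ltcR => e0.
near=> b; rewrite -rmorphB normc_def /= expr0n addr0 sqrtr_sqr ltcR.
by near: b; apply: cvgr_dist_lt.
Unshelve. all: by end_near. Qed.

(** Since i^k = i^(odd k) (-1)^(k./2), the even terms of the exponential series are those of the
    cosine, and the odd terms are i times those of the sine. *)
Lemma exp_coeff_cis t k :
  k`!%:R^-1 * ('i * t%:C%C) ^+ k
  = (cos_coeff t k)%:C%C + 'i * (sin_coeff t k)%:C%C :> C.
Proof.
rewrite /cos_coeff /sin_coeff /= exprMn !(rmorphM, rmorphXn, fmorphV) /= !rmorph_nat.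
rewrite rmorphN1 -{2}(odd_double_half k) exprD -mul2n exprM sqrCi.
case: (boolP (odd k)) => hk /=.
  (* [sin_coeff] carries the sign (-1)^(k.-1./2), which for odd k agrees with the power of i^2. *)
  rewrite expr1; have -> : k.-1./2 = k./2.
    by rewrite -{1}(odd_double_half k) hk /= add0n doubleK.
  by ring.
by rewrite expr0; ring.
Qed.

Lemma cvg_series_cis t :
  (fun n => \sum_(0 <= k < n) k`!%:R^-1 * ('i * t%:C%C) ^+ k : K) @ \oo
    --> (cis t : K).
Proof.
have -> : (fun n => \sum_(0 <= k < n) k`!%:R^-1 * ('i * t%:C%C) ^+ k : K) =
    (fun n => (series (cos_coeff t) n)%:C%C
              + 'i * (series (sin_coeff t) n)%:C%C).
  apply/funext => n; rewrite /series /= !rmorph_sum mulr_sumr -big_split /=.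
  by apply: eq_bigr => k _; rewrite exp_coeff_cis.
have cvgC (u : nat -> R) (l : R) : u @ \oo --> l ->
    (fun n => (u n)%:C%C : K) @ \oo --> (l%:C%C : K).
  by move=> ul; apply: continuous_cvg => //; exact: real_complex_continuous.
rewrite /cis; apply: cvgD; last apply: cvgMr.
  by apply: cvgC; rewrite unlock; exact: is_cvg_series_cos_coeff.
by apply: cvgC; rewrite unlock; exact: is_cvg_series_sin_coeff.
Qed.

(** Each partial sum is a combination of the fixed matrices [D j] whose coefficients are partial
    sums of scalar series; these converge to [cis (t j)], and the limit is unique because the matrix
    space is Hausdorff. *)
Lemma expmx_unitary_diag n (P : 'M[C]_n) (t : 'I_n -> R) : P \is unitarymx ->
  expmx (P ^t* *m diag_mx (\row_j ('i * (t j)%:C%C)) *m P)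
  = P ^t* *m diag_mx (\row_j cis (t j)) *m P.
Proof.
move=> PU; set z := \row_j ('i * _).
pose D j : 'M[K]_n := P ^t* *m delta_mx j j *m P.
have cvgS : \sum_j (fun m => (\sum_(0 <= k < m)
    k`!%:R^-1 * ('i * (t j)%:C%C) ^+ k : K) *: D j) @ \oo
    --> \sum_j (cis (t j) : K) *: D j.
  apply: (big_ind2 (fun (u : nat -> 'M[K]_n) (l : 'M[K]_n) => u @ \oo --> l)).
  - exact: cvg_cst.
  - by move=> u l u' l'; exact: cvgD.
  - by move=> j _; apply: cvgZr_tmp; exact: cvg_series_cis.
rewrite [RHS]conj_diag_sum; under [RHS]eq_bigr do rewrite mxE.
rewrite -[RHS](cvg_lim (@norm_hausdorff K 'M[K]_n) cvgS).
rewrite /expmx (_ : series _ = \sum_j (fun m => (\sum_(0 <= k < m)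
    k`!%:R^-1 * ('i * (t j)%:C%C) ^+ k : K) *: D j)) //.
apply/funext => m; rewrite /series /= fct_sumE.
under eq_bigr do rewrite unitary_diag_exp // conj_diag_sum scaler_sumr.
rewrite exchange_big; apply: eq_bigr => j _ /=.
by rewrite scaler_suml; apply: eq_bigr => k _; rewrite !mxE scalerA.
Qed.

End Cis.

(** * Conjugation by the exponential of a Hermitian matrix *)

Section Heisenberg.
Variables (R : realType) (n : nat).
Local Notation C := R[i].

(** The spectral theorem gives real eigenvalues, so the exponents are purely imaginary and every
    factor of the exponential is a [cis]. One P serves all x. *)
Lemma expmx_hermitian_spectral (A : 'M[C]_n) : A \is hermsymmx ->
  exists P : 'M[C]_n, exists d : 'I_n -> R, [/\ P \is unitarymx,
    A = P ^t* *m diag_mx (\row_j (d j)%:C%C) *m P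
  & forall x : R, expmx (- ('i * x%:C%C / 2) *: A)
      = P ^t* *m diag_mx (\row_j cis (- (x * d j / 2))) *m P].
Proof.
move=> Aherm; pose P := spectralmx A.
pose d j := complex.Re (spectral_diag A 0 j).
have PU : P \is unitarymx by exact: spectral_unitarymx.
have dE : spectral_diag A = \row_j (d j)%:C%C.
  apply/rowP => j; rewrite mxE /d RRe_real //.
  by have /mxOverP := hermitian_spectral_diag_real Aherm; apply.
have AE : A = P ^t* *m diag_mx (\row_j (d j)%:C%C) *m P.
  rewrite -dE -invmx_unitary //.
  by have /orthomx_spectralP := hermitian_normalmx Aherm.
exists P, d; split; [exact: PU|exact: AE|move=> x].
rewrite -(expmx_unitary_diag (fun j => - (x * d j / 2)) PU).
suff -> : - ('i * x%:C%C / 2) *: A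
    = P ^t* *m diag_mx (\row_j ('i * (- (x * d j / 2))%:C%C)) *m P by [].
rewrite {1}AE conj_diagZ; congr (_ *m diag_mx _ *m _).
apply/rowP => j; rewrite !mxE.
by rewrite rmorphN !rmorphM fmorphV rmorph_nat /=; ring.
Qed.

(** In the eigenbasis, a nonzero entry (j, k) of E has d_j - d_k = -2w and acquires the phase
    e^{ix(d_j - d_k)/2} = e^{-iwx}; the half in the exponent absorbs the 2 of the commutator. *)
Lemma Heisenberg_eigenvector (A E : 'M[C]_n) (w x : R) : A \is hermsymmx ->
    commutator A E = (- (2 * w%:C%C)) *: E ->
  let U := expmx (- ('i * x%:C%C / 2) *: A) in
  U ^t* * E * U = cis (- (w * x)) *: E.
Proof.
move=> /expmx_hermitian_spectral [P [d [PU AE UE]]] AEcomm /=.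
rewrite {}UE.
have key := @unitary_conj_eigenvector _ _ P (\row_j (d j)%:C%C)
  (\row_j cis (- (x * d j / 2))) E (- (2 * w%:C%C)) (cis (- (w * x))) PU.
apply: key; last by rewrite -AE.
move=> j k; rewrite !mxE => dw.
have {}dw : d j - d k = - (2 * w).
  by apply: (@complexI R); rewrite !(rmorphB, rmorphN, rmorphM) rmorph_nat.
rewrite -cisN opprK -cisD; congr cis.
by move: dw => /eqP; rewrite subr_eq => /eqP ->; field.
Qed.

End Heisenberg.

(** * Tensor products in binary coordinates *)

Section Bits.

Lemma eq_binary_digits m (x y : nat) : (x < 2 ^ m)%N -> (y < 2 ^ m)%N ->
  (forall i, (i < m)%N -> (x %/ 2 ^ i) %% 2 = (y %/ 2 ^ i) %% 2)%N -> x = y.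
Proof.
elim: m x y => [|m IHm] x y.
  by rewrite expn0 !ltnS !leqn0 => /eqP -> /eqP ->.
move=> xm ym xy.
have xy0 : (x %% 2 = y %% 2)%N by have := xy 0%N isT; rewrite expn0 !divn1.
rewrite (divn_eq x 2) (divn_eq y 2) xy0; congr (_ * _ + _)%N.
apply: IHm; rewrite ?ltn_divLR // -?expnSr // => i im.
by rewrite -!divnMA -expnS; exact: xy.
Qed.

Lemma binary_digit_mod m k x : (k < m)%N ->
  (((x %% 2 ^ m) %/ 2 ^ k) %% 2 = (x %/ 2 ^ k) %% 2)%N.
Proof.
by move=> km; rewrite !modn_divl -expnS modn_dvdm // dvdn_exp2l.
Qed.

Variable N : nat.
Implicit Types (x y : 'I_(2 ^ N)) (j : 'I_N).

(* The first factor of a Kronecker product is the most significant digit. *)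
Definition bit j x : 'I_2 := Ordinal (ltn_pmod (x %/ 2 ^ (N - j.+1)) (isT : 0 < 2)%N).

Definition bits x : {ffun 'I_N -> 'I_2} := [ffun j => bit j x].

Lemma bits_bij : bijective bits.
Proof.
apply: inj_card_bij => [x y /ffunP xy|]; last by rewrite card_ffun !card_ord.
apply: val_inj; apply: (@eq_binary_digits N); try exact: ltn_ord.
move=> i iN.
(* Digit i of the index, counted from the least significant one, is the bit of qubit N - i.+1. *)
have jN : (N - i.+1 < N)%N by rewrite ltn_subrL (leq_trans _ iN).
have := congr1 val (xy (Ordinal jN)); rewrite !ffunE /=.
by rewrite subnSK // subKn // ltnW.
Qed.

(** The left side is the condition for both identity factors of [site] to have entry 1: qubit n sits
    at digit N - n.+1, the first identity sees the digits above it, the second one those below. *)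
Lemma eq_other_bits (n : 'I_N) x y :
  ((x %/ 2 ^ (N - n.+1)) %/ 2 == (y %/ 2 ^ (N - n.+1)) %/ 2)%N
  && (x %% 2 ^ (N - n.+1) == y %% 2 ^ (N - n.+1))%N
  = [forall j, (j != n) ==> (bit j x == bit j y)].
Proof.
set m := (N - n.+1)%N; have nN := ltn_ord n.
apply/andP/forallP => [[/eqP hi /eqP lo] j|xy].
  apply/implyP => jn; apply/eqP/val_inj => /=.
  have := ltn_ord j; case: (ltngtP j n) => [jltn|ngtj|/val_inj jn'] jN.
  - have -> : (N - j.+1 = m.+1 + (n - j.+1))%N by rewrite /m; lia.
    by rewrite expnD !divnMA expnSr !divnMA hi.
  - have km : (N - j.+1 < m)%N by rewrite /m; lia.
    by rewrite -(binary_digit_mod x km) lo binary_digit_mod.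
  - by rewrite jn' eqxx in jn.
have eq_bit (j : nat) : (j < N)%N -> j <> n ->
    (x %/ 2 ^ (N - j.+1) %% 2 = y %/ 2 ^ (N - j.+1) %% 2)%N.
  move=> jN jn; have /implyP xyj := xy (Ordinal jN).
  apply: (congr1 val (eqP (xyj _))).
  by apply/eqP => /(congr1 val).
split; apply/eqP.
  have lt_hi (z : 'I_(2 ^ N)) : (z %/ 2 ^ m %/ 2 < 2 ^ n)%N.
    rewrite -divnMA -expnSr ltn_divLR ?expn_gt0 // -expnD /m.
    by rewrite subnSK // subnKC // ltnW.
  apply: (eq_binary_digits (lt_hi x) (lt_hi y)) => i im.
  rewrite -(divnMA x) -(divnMA y) -expnSr -!divnMA -expnD.
  have -> : (m.+1 + i = N - (n - i.+1).+1)%N by rewrite /m; lia.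
  by apply: eq_bit; lia.
apply: (@eq_binary_digits m); rewrite ?ltn_pmod ?expn_gt0 // => i im.
rewrite !binary_digit_mod //.
have -> : (i = N - (N - i.+1).+1)%N by move: im; rewrite /m; lia.
by apply: eq_bit; move: im; rewrite /m; lia.
Qed.

End Bits.

(** * Tensor products of one-qubit matrices, described entrywise *)

Section TensorFamilies.
Variables (C : comNzRingType) (N : nat).
Implicit Types A B : 'I_N -> 'M[C]_2.

(** The tensor product of all the A j, given by its entries so that no nested Kronecker product or
    dimension cast appears. *)
Definition tensor_family A : 'M[C]_(2 ^ N) :=
  \matrix_(x, y) \prod_j A j (bit j x) (bit j y).

Lemma sum_bits (F : {ffun 'I_N -> 'I_2} -> C) :
  \sum_x F (bits x) = \sum_f F f.
Proof. by rewrite (reindex _ (onW_bij _ (bits_bij N))). Qed.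

Lemma eq_tensor_family A B : A =1 B -> tensor_family A = tensor_family B.
Proof.
by move=> AB; apply/matrixP => x y; rewrite !mxE; apply: eq_bigr => j _; rewrite AB.
Qed.

(** Distributing the product over the N two-term sums gives a sum over bit vectors, which [bits]
    identifies with the intermediate indices of the large matrix product. *)
Lemma tensor_family_mul A B :
  tensor_family A *m tensor_family B = tensor_family (fun j => A j *m B j).
Proof.
apply/matrixP => x y; rewrite !mxE.
under [RHS]eq_bigr do rewrite mxE.
rewrite bigA_distr_bigA -sum_bits; apply: eq_bigr => z _.
by rewrite !mxE -big_split; apply: eq_bigr => j _; rewrite ffunE.
Qed.

Lemma tensor_family1 : tensor_family (fun=> 1%:M) = 1%:M.
Proof.
apply/matrixP => x y; rewrite !mxE; have [->|xy] := eqVneq x y.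
  by rewrite big1 // => j _; rewrite mxE eqxx.
have [j xyj] : exists j, bit j x != bit j y.
  apply/existsP; apply: contraNT xy => /existsPn xy; apply/eqP.
  apply: (bij_inj (bits_bij N)); apply/ffunP => j; rewrite !ffunE.
  by apply/eqP; rewrite -[_ == _]negbK xy.
by rewrite (bigD1 j) //= mxE (negPf xyj) mul0r.
Qed.

Lemma tensor_family_tr A : \tr (tensor_family A) = \prod_j \tr (A j).
Proof.
rewrite bigA_distr_bigA -sum_bits; apply: eq_bigr => x _.
by rewrite mxE; apply: eq_bigr => j _; rewrite ffunE.
Qed.

(** Matrix units factor over the qubits; this reduces the spanning property of the words to the
    one-qubit case. *)
Lemma tensor_family_delta x y :
  tensor_family (fun j => delta_mx (bit j x) (bit j y)) = delta_mx x y.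
Proof.
apply/matrixP => x' y'; rewrite !mxE.
have [/andP[/eqP -> /eqP ->]|] := boolP ((x' == x) && (y' == y)).
  by rewrite big1 // => j _; rewrite mxE !eqxx.
move=> xy; have [j xyj] : exists j, ~~ ((bit j x' == bit j x) && (bit j y' == bit j y)).
  apply/existsP; apply: contraNT xy => /existsPn xy.
  by apply/andP; split; apply/eqP/(bij_inj (bits_bij N))/ffunP => j;
    have /negPn/andP[/eqP ex /eqP ey] := xy j; rewrite !ffunE.
by rewrite (bigD1 j) //= mxE (negPf xyj) mul0r.
Qed.

Lemma tensor_family_expand (I : finType) (a : 'I_N -> I -> C) (M : I -> 'M[C]_2) :
  tensor_family (fun j => \sum_p a j p *: M p)
  = \sum_(f : {ffun 'I_N -> I}) (\prod_j a j (f j)) *: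
      tensor_family (fun j => M (f j)).
Proof.
apply/matrixP => x y; rewrite mxE summxE.
under eq_bigr do rewrite summxE.
rewrite bigA_distr_bigA; apply: eq_bigr => f _.
by rewrite !mxE -big_split; apply: eq_bigr => j _; rewrite mxE.
Qed.

Implicit Types (n : 'I_N) (D : 'M[C]_2).

Definition replace A n D := fun j => if j == n then D else A j.

Lemma tensor_family_replace A n D x y :
  tensor_family (replace A n D) x y =
  D (bit n x) (bit n y) * \prod_(j | j != n) A j (bit j x) (bit j y).
Proof.
rewrite mxE (bigD1 n) //= /replace eqxx; congr (_ * _).
by apply: eq_bigr => j /negPf ->.
Qed.

Lemma tensor_family_replaceD A n D D' :
  tensor_family (replace A n (D + D'))
  = tensor_family (replace A n D) + tensor_family (replace A n D').
Proof.
apply/matrixP => x y; rewrite [RHS]mxE !tensor_family_replace.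
by rewrite !mxE mulrDl.
Qed.

Lemma tensor_family_replaceZ A n c D :
  tensor_family (replace A n (c *: D)) = c *: tensor_family (replace A n D).
Proof.
by apply/matrixP => x y; rewrite [RHS]mxE !tensor_family_replace mxE mulrA.
Qed.

(** Induction on a duplicate-free list: a new factor meets only the identity at its own position. *)
Lemma tensor_family_prod (S : {set 'I_N}) D :
  \prod_(j in S) tensor_family (replace (fun=> 1%:M) j D)
  = tensor_family (fun j => if j \in S then D else 1%:M) :> 'M[C]_(2 ^ N).
Proof.
have fold (s : seq 'I_N) : uniq s ->
    \prod_(j <- s) tensor_family (replace (fun=> 1%:M) j D)
    = tensor_family (fun j => if j \in s then D else 1%:M) :> 'M[C]_(2 ^ N).
  elim: s => [_|n s IHs /= /andP[ns us]].
    by rewrite big_nil -[LHS]/1%:M -tensor_family1; apply: eq_tensor_family.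
  rewrite big_cons IHs // -[LHS]/(_ *m _) tensor_family_mul.
  apply: eq_tensor_family => j; rewrite /replace inE.
  by case: eqVneq => [->|_]; rewrite ?(negPf ns) ?mulmx1 ?mul1mx.
rewrite -big_filter fold ?filter_uniq ?index_enum_uniq //.
by apply: eq_tensor_family => j; rewrite mem_filter mem_index_enum andbT.
Qed.

End TensorFamilies.

Lemma trmxC_tensor_family (C : numClosedFieldType) N (A : 'I_N -> 'M[C]_2) :
  (tensor_family A) ^t* = tensor_family (fun j => (A j) ^t*).
Proof.
apply/matrixP => x y; rewrite !mxE rmorph_prod.
by apply: eq_bigr => j _; rewrite !mxE.
Qed.

Section Sites.
Variables (R : realType) (N : nat).
Local Notation C := R[i].

(** The bridge from Kronecker products to [tensor_family]: the entries of the two identity factors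
    combine into one boolean, evaluated by [eq_other_bits]. *)
Lemma siteE (D : 'M[C]_2) (n : 'I_N) :
  site D n = tensor_family (replace (fun=> 1%:M) n D).
Proof.
apply/matrixP => x y; rewrite tensor_family_replace /site castmxE /=.
rewrite !mxE /=.
rewrite mulrAC mulrC -natrM mulnb.
congr (_ * _); first by congr (D _ _); apply: val_inj.
under eq_bigr do rewrite mxE.
transitivity ((nat_of_bool [forall j, (j != n) ==> (bit j x == bit j y)])%:R : C).
  by rewrite -eq_other_bits.
case: forallP => [xy|/forallP/forallPn [j]].
  by rewrite big1 // => j /(implyP (xy j)) ->.
by rewrite negb_imply => /andP[jn /negPf xyj]; rewrite (bigD1 j) //= xyj mul0r.
Qed.

End Sites.

(** * Words in the letters E^+, E^-, X, I *)

Section PauliBasis.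
Variable R : realType.
Local Notation C := R[i].
Implicit Types (a b c d : C) (p q : bool * bool).

Lemma mx2_ind (D : 'M[C]_2) : D = mx2 (D 0 0) (D 0 1) (D 1 0) (D 1 1).
Proof.
by apply/matrixP => i j; rewrite mxE; case: i => [[|[|//]] hi];
  case: j => [[|[|//]] hj] /=; congr (D _ _); apply: val_inj.
Qed.

Lemma mx2_mul a b c d a' b' c' d' : mx2 a b c d *m mx2 a' b' c' d'
  = mx2 (a * a' + b * c') (a * b' + b * d') (c * a' + d * c') (c * b' + d * d').
Proof.
by rewrite [LHS]mx2_ind; congr mx2; rewrite mxE !big_ord_recl big_ord0 !mxE addr0.
Qed.

Lemma mx2D a b c d a' b' c' d' :
  mx2 a b c d + mx2 a' b' c' d' = mx2 (a + a') (b + b') (c + c') (d + d').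
Proof. by rewrite [LHS]mx2_ind; congr mx2; rewrite !mxE. Qed.

Lemma mx2Z k a b c d : k *: mx2 a b c d = mx2 (k * a) (k * b) (k * c) (k * d).
Proof. by rewrite [LHS]mx2_ind; congr mx2; rewrite !mxE. Qed.

Lemma mx2_trmxC a b c d : (mx2 a b c d) ^t* = mx2 a^* c^* b^* d^*.
Proof. by rewrite [LHS]mx2_ind; congr mx2; rewrite !mxE. Qed.

Lemma mx2_tr a b c d : \tr (mx2 a b c d) = a + d.
Proof. by rewrite /mxtrace !big_ord_recl big_ord0 !mxE addr0. Qed.

Lemma mx2_1 : 1%:M = mx2 1 0 0 1 :> 'M[C]_2.
Proof. by rewrite [LHS]mx2_ind; congr mx2; rewrite !mxE. Qed.

(* The letters (true, true), (true, false), (false, true), (false, false)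
   stand for E^+, E^-, X, I. *)
Definition letter p : 'M[C]_2 :=
  if p.1 then pauliZ R + (if p.2 then 'i else - 'i) *: pauliY R
  else if p.2 then pauliX R else 1%:M.

Definition letter_sign p : int := if p.1 then (if p.2 then 1 else -1) else 0.

Definition letter_adj p := if p.1 then (true, ~~ p.2) else p.

(** As iY is real, every letter has entries in {-1, 0, 1}, and the one-qubit identities become
    finite computations. *)
Lemma letterE p : letter p =
  if p.1 then (if p.2 then mx2 1 1 (-1) (-1) else mx2 1 (-1) 1 (-1))
  else if p.2 then mx2 0 1 1 0 else mx2 1 0 0 1.
Proof.
case: p => [[] []]; rewrite /letter /= -?mx2_1 // /pauliZ /pauliY mx2Z mx2D;
  have := @sqrCi C; rewrite expr2 => ii; congr mx2; ring: ii.
Qed.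

Lemma letter_adjP p : (letter p) ^t* = letter (letter_adj p).
Proof.
by case: p => [[] []]; rewrite !letterE /= mx2_trmxC ?rmorphN ?rmorph0 ?rmorph1.
Qed.

Lemma letter_orthogonal p q : \tr ((letter p) ^t* *m letter q)
  = if p == q then 2 * 2 ^+ p.1 else 0.
Proof.
rewrite letter_adjP.
by case: p q => [[] []] [[] []]; rewrite !letterE /= mx2_mul mx2_tr; ring.
Qed.

Lemma letter_commX p :
  pauliX R *m letter p
  = letter p *m pauliX R + (- (2 * (letter_sign p)%:~R)) *: letter p.
Proof.
by case: p => [[] []]; rewrite !letterE /= !mx2_mul mx2Z mx2D; congr mx2;
  rewrite /letter_sign /= ?rmorphN ?rmorph0 ?rmorph1; ring.
Qed.

Lemma letter_span (D : 'M[C]_2) : exists k : bool * bool -> C,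
  D = \sum_p k p *: letter p.
Proof.
(* The coefficients are tr(L^* D) / tr(L^* L) for each letter L; the squared norm is 4 for E^+ and
   E^-, and 2 for X and I. *)
pose k (active plus : bool) := let: s := if plus then 1 else -1 in
  if active then (D 0 0 - D 1 1 + s * (D 0 1 - D 1 0)) / 4
  else if plus then (D 0 1 + D 1 0) / 2 else (D 0 0 + D 1 1) / 2.
exists (fun p => k p.1 p.2).
transitivity (\sum_s \sum_t k s t *: letter (s, t)); last first.
  by rewrite pair_bigA; apply: eq_bigr => -[].
rewrite !big_bool !letterE /= !mx2Z !mx2D [LHS]mx2_ind /k.
by congr mx2; field.
Qed.

End PauliBasis.

(** * The normalized trace inner product *)

Section Inner.
Variables (R : realType) (N : nat).
Local Notation C := R[i].
Local Notation op := (op R N).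
Implicit Types (A B D : op) (k : C).

Lemma innerDr A B D : inner A (B + D) = inner A B + inner A D.
Proof. by rewrite /inner -!mulmxE mulmxDr linearD mulrDr. Qed.

Lemma innerZr k A B : inner A (k *: B) = k * inner A B.
Proof. by rewrite /inner -!mulmxE -scalemxAr linearZ /= mulrCA. Qed.

Lemma inner_sumr (I : Type) (r : seq I) (Q : pred I) A (F : I -> op) :
  inner A (\sum_(i <- r | Q i) F i) = \sum_(i <- r | Q i) inner A (F i).
Proof.
apply: (big_morph (inner A)) => [B D|]; first exact: innerDr.
by rewrite -(scale0r A) innerZr mul0r.
Qed.

Lemma inner_conj A B : (inner A B)^* = inner B A.
Proof.
rewrite /inner rmorphM fmorphV rmorphXn rmorph_nat; congr (_ * _).
rewrite -trace_map_mx -mxtrace_tr map_trmx -!mulmxE trmx_mul map_mxM.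
by rewrite trmxCK.
Qed.

Lemma innerDl A B D : inner (A + B) D = inner A D + inner B D.
Proof. by rewrite -[LHS]inner_conj innerDr rmorphD /= !inner_conj. Qed.

Lemma innerZl k A B : inner (k *: A) B = k^* * inner A B.
Proof. by rewrite -[LHS]inner_conj innerZr rmorphM /= inner_conj. Qed.

Lemma inner_def A : inner A A = 0 -> A = 0.
Proof.
move=> /eqP; rewrite mulf_eq0 invr_eq0 expf_eq0 pnatr_eq0 andbF /=.
(* The trace is the sum of the squared moduli of the entries, all of which must then vanish. *)
have -> : \tr (A ^t* * A) = \sum_y \sum_x (A x y)^* * A x y.
  by apply: eq_bigr => y _; rewrite mxE; apply: eq_bigr => x _; rewrite !mxE.
have pos x y : 0 <= (A x y)^* * A x y by rewrite mulrC mul_conjC_ge0.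
rewrite psumr_eq0 => [/allP Aeq0|y _]; last exact: sumr_ge0.
apply/matrixP => x y; rewrite mxE; apply/eqP.
have := Aeq0 y (mem_index_enum _); rewrite psumr_eq0 //= => /allP.
by move=> /(_ x (mem_index_enum _)); rewrite mulrC mul_conjC_eq0.
Qed.

Lemma mxtrace_inner A B : A \is hermsymmx -> \tr (A * B) = 2 ^+ N * inner A B.
Proof.
move=> /is_hermitianmxP; rewrite expr0 scale1r => {1}->.
by rewrite /inner mulVKf // expf_neq0 // pnatr_eq0.
Qed.

End Inner.

(** * The orthogonal basis of words and the action of G on it *)

Section Words.
Variables (R : realType) (N : nat).
Local Notation C := R[i].
Local Notation op := (op R N).
Local Notation word := {ffun 'I_N -> bool * bool}.
Implicit Types (f g : word) (A B : op) (k : triple N).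

Definition word_op f : op := tensor_family (fun j => letter R (f j)).

Definition word_freq f : int := \sum_j letter_sign (f j).

Definition word_active f : nat := \sum_j (f j).1.

Definition word_adj f : word := [ffun j => letter_adj (f j)].

Lemma word_adjK : involutive word_adj.
Proof. by move=> f; apply/ffunP => j; rewrite !ffunE; case: (f j) => [[] []]. Qed.

Lemma word_freq_adj f : word_freq (word_adj f) = - word_freq f.
Proof.
rewrite /word_freq -sumrN; apply: eq_bigr => j _.
by rewrite ffunE; case: (f j) => [[] []].
Qed.

Lemma word_active_adj f : word_active (word_adj f) = word_active f.
Proof.
by apply: eq_bigr => j _; rewrite ffunE; case: (f j) => [[] []].
Qed.

Lemma word_freq_le f : `|word_freq f| <= N%:Z.
Proof.
apply: le_trans (ler_norm_sum _ _ _) _.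
have -> : N%:Z = \sum_(j < N) 1 by rewrite sumr_const card_ord natz.
by apply: ler_sum => j _; case: (f j) => [[] []].
Qed.

Lemma word_op_adj f : (word_op f) ^t* = word_op (word_adj f).
Proof.
rewrite /word_op trmxC_tensor_family; apply: eq_tensor_family => j.
by rewrite letter_adjP ffunE.
Qed.

(** The trace factors over the qubits; the normalization cancels one 2 per qubit, leaving one 2 per
    active letter. *)
Lemma word_orthogonal f g :
  inner (word_op f) (word_op g) = if f == g then 2 ^+ word_active f else 0.
Proof.
rewrite /inner trmxC_tensor_family -[_ * tensor_family _]/(_ *m _).
rewrite tensor_family_mul tensor_family_tr.
under eq_bigr do rewrite letter_orthogonal.
case: eqVneq => [->|fg].
  under eq_bigr do rewrite eqxx.
  rewrite big_split /= prodr_const card_ord prodrXr.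
  by rewrite mulKf // expf_neq0 // pnatr_eq0.
have [j fgj] : exists j, f j != g j.
  by apply/existsP; apply: contraNT fg => /existsPn fg; apply/eqP/ffunP => j;
    apply/eqP; rewrite -[_ == _]negbK fg.
by rewrite (bigD1 j) //= (negPf fgj) mul0r mulr0.
Qed.

Lemma G_hermitian : G R N \is hermsymmx.
Proof.
apply/is_hermitianmxP; rewrite expr0 scale1r /G raddf_sum raddf_sum /=.
apply: eq_bigr => n _; rewrite siteE trmxC_tensor_family.
apply: eq_tensor_family => j; rewrite /replace.
case: (j == n); first by rewrite mx2_trmxC rmorph0 rmorph1.
by rewrite trmx1 map_mx1.
Qed.

(** The summand of G at qubit n touches only the n-th letter, where [letter_commX] applies; the
    signs add up to the frequency. *)
Lemma commutator_word f :
  commutator (G R N) (word_op f) = (- (2 * (word_freq f)%:~R)) *: word_op f.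
Proof.
rewrite /commutator /G mulr_suml mulr_sumr -sumrB.
rewrite /word_freq rmorph_sum mulr_sumr -sumrN scaler_suml.
apply: eq_bigr => n _; rewrite siteE -[_ * word_op f]/(_ *m _).
rewrite -[word_op f * _]/(_ *m _) !tensor_family_mul.
rewrite (@eq_tensor_family _ _ _ (replace (fun j => letter R (f j)) n
  (letter R (f n) *m pauliX R
   + (- (2 * (letter_sign (f n))%:~R)) *: letter R (f n)))); last first.
  move=> j; rewrite /replace; case: eqVneq => [->|_]; last by rewrite mul1mx.
  by rewrite letter_commX.
rewrite tensor_family_replaceD tensor_family_replaceZ addrC addrA.
rewrite (@eq_tensor_family _ _ _ (replace (fun j => letter R (f j)) n
  (letter R (f n) *m pauliX R))); last first.
  by move=> j; rewrite /replace; case: eqVneq => [->|_] //; rewrite mulmx1.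
rewrite addNr add0r; congr (_ *: _); apply: eq_tensor_family => j.
by rewrite /replace; case: eqVneq => [->|].
Qed.

(** Each matrix unit is a tensor product of one-qubit units; expanding these on the letters and
    using multilinearity gives words. *)
Lemma word_span A : exists a : word -> C, A = \sum_f a f *: word_op f.
Proof.
have [a aE] := choice (fun xyj : 'I_(2 ^ N) * 'I_(2 ^ N) * 'I_N =>
  letter_span (delta_mx (bit xyj.2 xyj.1.1) (bit xyj.2 xyj.1.2) : 'M[C]_2)).
exists (fun f => \sum_xy A xy.1 xy.2 * \prod_j a (xy, j) (f j)).
under eq_bigr do rewrite scaler_suml.
rewrite exchange_big /= {1}[A]matrix_sum_delta pair_bigA; apply: eq_bigr => xy _.
under [RHS]eq_bigr do rewrite -scalerA.
rewrite -scaler_sumr; congr (_ *: _).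
rewrite -[RHS](tensor_family_expand (fun j => a (xy, j)) (letter R)).
rewrite -[LHS]tensor_family_delta; apply: eq_tensor_family => j.
exact: (aE (xy, j)).
Qed.

(** The Fourier coefficient of A: the inner product divided by the squared norm of the word. *)
Definition word_coef A f : C := 2 ^- word_active f * inner (word_op f) A.

Lemma word_expansion A : A = \sum_f word_coef A f *: word_op f.
Proof.
have [a AE] := word_span A; rewrite {1}AE; apply: eq_bigr => f _; congr (_ *: _).
rewrite /word_coef AE inner_sumr (bigD1 f) //= innerZr word_orthogonal eqxx.
rewrite big1 ?addr0 => [|g gf].
  by rewrite mulrCA mulVf ?mulr1 // expf_neq0 // pnatr_eq0.
by rewrite innerZr word_orthogonal eq_sym (negPf gf) mulr0.
Qed.

(** Taking adjoints is an involution that negates the frequency, so the words of negative frequency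
    are folded onto those of positive frequency. *)
Lemma sum_words_by_freq (V : zmodType) (F : word -> V) :
  \sum_f F f = \sum_(f | word_freq f == 0) F f
    + \sum_(1 <= w < N.+1) \sum_(f | word_freq f == w%:Z) (F f + F (word_adj f)).
Proof.
rewrite (bigID (fun f => word_freq f == 0)) /=; congr (_ + _).
under [RHS]eq_bigr do rewrite big_mkcond.
rewrite exchange_big /=.
transitivity (\sum_f (if 0 < word_freq f then F f + F (word_adj f) else 0)).
  rewrite -big_mkcond big_split /= (bigID (fun f => 0 < word_freq f)) /=.
  congr (_ + _); first by apply: eq_bigl => f; case: ltrgt0P.
  rewrite (reindex_inj (inv_inj word_adjK)); apply: eq_bigl => f /=.
  by rewrite word_freq_adj oppr_eq0 oppr_gt0; case: ltrgt0P.
apply: eq_bigr => f _; rewrite -big_mkcond /=.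
have f_le := word_freq_le f.
have [f0|f0] := ltP 0 (word_freq f).
  (* A positive frequency is at most N, so exactly one w of the range matches it. *)
  rewrite (eq_bigl (pred1 `|word_freq f|%N)) => [|w /=]; last first.
    by apply/eqP/eqP; lia.
  by rewrite big_nat1_eq ifT //; lia.
by rewrite big_nat_cond big_pred0 // => w; apply/negP => /andP[w1 /eqP fw]; lia.
Qed.

End Words.

(** * Configurations and invariant pairs *)

Section ConfigWords.
Variable N : nat.
Local Notation word := {ffun 'I_N -> bool * bool}.
Implicit Types (f : word) (k : triple N).

Definition config_word k : word := [ffun j =>
  if j \in splus k then (true, true) else
  if j \in sminus k then (true, false) else (false, j \in tset k)].

Definition word_config f : triple N :=
  ([set j | f j == (true, true)]%SET, [set j | f j == (true, false)]%SET,
   [set j | f j == (false, true)]%SET).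

Lemma word_configK : cancel word_config config_word.
Proof.
by move=> f; apply/ffunP => j; rewrite ffunE !inE; case: (f j) => [[] []].
Qed.

Lemma config_wordK k : is_config k -> word_config (config_word k) = k.
Proof.
case: k => [[Sp Sm] T] /and3P[]; rewrite /splus /sminus /tset /=.
move=> /disjointFr pm /disjointFr pt /disjointFr mt.
have letterP j : config_word (Sp, Sm, T) j =
    if j \in Sp then (true, true) else
    if j \in Sm then (true, false) else (false, j \in T) by rewrite ffunE.
rewrite /word_config; congr pair; first congr pair;
  apply/setP => j; rewrite inE letterP.
- by case: ifP => //; case: ifP.
- by case: ifP => [/pm ->|_] //; case: ifP => //; case: (j \in T).
- by case: ifP => [/pt ->|_] //; case: ifP => [/mt ->|_] //; case: (j \in T).
Qed.

Lemma word_config_is_config f : is_config (word_config f).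
Proof.
by apply/and3P; split; rewrite -setI_eq0; apply/eqP/setP => j; rewrite !inE;
  case: (f j) => [[] []].
Qed.

Lemma freq_word_config f : freq (word_config f) = word_freq f.
Proof.
have card_sum (S : {set 'I_N}) : #|S|%:Z = \sum_j (j \in S)%:Z.
  by rewrite -sum1_card big_mkcond (big_morph Posz PoszD (erefl _)).
rewrite /freq !card_sum -sumrB; apply: eq_bigr => j _.
by rewrite !inE; case: (f j) => [[] []].
Qed.

Lemma freq_config_word k : is_config k -> word_freq (config_word k) = freq k.
Proof. by move=> hk; rewrite -freq_word_config config_wordK. Qed.

Lemma active_word_config f : active (word_config f) = word_active f.
Proof.
rewrite /active /word_active /splus /sminus /= -!sum1_card.
rewrite big_mkcond [X in (_ + X)%N]big_mkcond -big_split /=.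
by apply: eq_bigr => j _; rewrite !inE; case: (f j) => [[] []].
Qed.

Lemma active_config_word k : is_config k -> word_active (config_word k) = active k.
Proof. by move=> hk; rewrite -active_word_config config_wordK. Qed.

Variables (c : forall w : nat, 'I_(nconf N w) -> triple N) (c_enum : enumerates c).

Lemma enumerates_in w (r : 'I_(nconf N w)) : (1 <= w <= N)%N -> c r \in configs N w.
Proof.
by move=> wN; rewrite -mem_enum -(perm_mem (c_enum wN)) codom_f.
Qed.

Lemma enumerates_is_config w (r : 'I_(nconf N w)) :
  (1 <= w <= N)%N -> is_config (@c w r).
Proof. by move=> wN; have := enumerates_in r wN; rewrite inE => /andP[]. Qed.

Lemma enumerates_freq w (r : 'I_(nconf N w)) : (1 <= w <= N)%N ->
  word_freq (config_word (@c w r)) = w%:Z.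
Proof.
move=> wN; have := enumerates_in r wN; rewrite inE => /andP[hk /eqP <-].
exact: freq_config_word.
Qed.

(** The word determines its frequency, hence w, and then r because an enumeration lists each
    configuration once. The dependent pairs allow r and r' to live in different types. *)
Lemma enumerates_inj w w' (r : 'I_(nconf N w)) (r' : 'I_(nconf N w')) :
  (1 <= w <= N)%N -> (1 <= w' <= N)%N ->
  config_word (c r) = config_word (c r') ->
  existT (fun v => 'I_(nconf N v)) w r = existT (fun v => 'I_(nconf N v)) w' r'.
Proof.
move=> wN w'N ww'.
have [ew] : w%:Z = w'%:Z.
  by rewrite -(enumerates_freq r wN) -(enumerates_freq r' w'N) ww'.
subst w'; congr existT.
have /injectiveP cinj : injectiveb (@c w).
  by rewrite /injectiveb /dinjectiveb -/(codom _) (perm_uniq (c_enum wN)) enum_uniq.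
apply: cinj; rewrite -(config_wordK (enumerates_is_config r wN)) ww'.
exact/config_wordK/enumerates_is_config.
Qed.

Lemma sum_enumerates (V : zmodType) w (F : word -> V) : (1 <= w <= N)%N ->
  \sum_(r < nconf N w) F (config_word (c r)) = \sum_(f | word_freq f == w%:Z) F f.
Proof.
move=> wN.
transitivity (\sum_(k <- codom (@c w)) F (config_word k)).
  by rewrite /codom big_image.
rewrite (perm_big _ (c_enum wN)) big_enum /=.
rewrite (reindex_onto word_config config_word) /= => [|k]; last first.
  by rewrite inE => /andP[hk _]; rewrite config_wordK.
apply: eq_big => [f|f _]; last by rewrite word_configK.
by rewrite word_configK eqxx andbT inE word_config_is_config freq_word_config.
Qed.

End ConfigWords.

(** Disjointness of the three sets leaves at most one factor different from the identity at each
    qubit. *)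
Lemma Econf_word (R : realType) N (k : triple N) : is_config k ->
  Econf R k = word_op R (config_word k).
Proof.
have EplusE (j : 'I_N) : Eplus R j
    = tensor_family (replace (fun=> 1%:M) j (letter R (true, true))).
  by rewrite tensor_family_replaceD tensor_family_replaceZ /Eplus !siteE.
have EminusE (j : 'I_N) : Eminus R j
    = tensor_family (replace (fun=> 1%:M) j (letter R (true, false))).
  by rewrite tensor_family_replaceD tensor_family_replaceZ /Eminus !siteE scaleNr.
move=> /and3P[/disjointFr pm /disjointFr pt /disjointFr mt]; rewrite /Econf.
rewrite (eq_bigr _ (fun j _ => EplusE j)) (tensor_family_prod (splus k)).
rewrite (eq_bigr _ (fun j _ => EminusE j)) (tensor_family_prod (sminus k)).
rewrite (eq_bigr _ (fun j _ => siteE (pauliX R) j)) (tensor_family_prod (tset k)).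
rewrite -[LHS]/(_ *m _ *m _).
rewrite (tensor_family_mul (fun j => if j \in splus k then _ else _)).
rewrite tensor_family_mul.
apply: eq_tensor_family => j; rewrite ffunE.
have [jp|jp] := boolP (j \in splus k); first by rewrite pm ?pt // !mulmx1.
rewrite mul1mx; have [jm|jm] := boolP (j \in sminus k).
  by rewrite mt // mulmx1.
by rewrite mul1mx; case: (j \in tset k).
Qed.

(** * Invariant pairs, the projection onto the commutant, and expectation values *)

Section Pairs.
Variables (R : realType) (N : nat).
Local Notation C := R[i].
Local Notation op := (op R N).
Local Notation word := {ffun 'I_N -> bool * bool}.
Implicit Types (f g : word) (A B O : op).

(** A common form for both members of a pair: the coefficients are (1, 1) for X and (-i, i) for
    Y. *)
Definition word_pair (a b : C) f : op :=
  a *: word_op R f + b *: word_op R (word_adj f).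

Lemma word_pairD a b a' b' f :
  word_pair a b f + word_pair a' b' f = word_pair (a + a') (b + b') f.
Proof. by rewrite /word_pair !scalerDl addrACA. Qed.

Lemma word_pairZ s a b f : s *: word_pair a b f = word_pair (s * a) (s * b) f.
Proof. by rewrite /word_pair scalerDr !scalerA. Qed.

(** Inverts the change of basis from a word and its adjoint to the vectors (1, 1) and (-i, i). *)
Lemma half_sum_difference (K : numClosedFieldType) (p q : K) :
  (p + q) / 2 - 'i * ('i * (p - q) / 2) = p
  /\ (p + q) / 2 + 'i * ('i * (p - q) / 2) = q.
Proof. by have := @sqrCi K; rewrite expr2 => ii; split; field: ii. Qed.

Lemma word_pair_decomp a b f : word_pair a b f
  = ((a + b) / 2) *: word_pair 1 1 f + ('i * (a - b) / 2) *: word_pair (- 'i) 'i f.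
Proof.
rewrite !word_pairZ word_pairD !mulr1 mulrN ![_ * 'i]mulrC.
by have [-> ->] := half_sum_difference a b.
Qed.

Lemma Xpair_word k : is_config k -> Xpair R k = word_pair 1 1 (config_word k).
Proof.
by move=> hk; rewrite /Xpair /word_pair Econf_word // word_op_adj !scale1r.
Qed.

Lemma Ypair_word k :
  is_config k -> Ypair R k = word_pair (- 'i) 'i (config_word k).
Proof.
move=> hk; rewrite /Ypair /word_pair Econf_word // word_op_adj invCi.
by rewrite scalerBr !scaleNr opprK.
Qed.

(** An adjoint of a word of positive frequency has negative frequency, so the cross terms vanish. *)
Lemma inner_word_pair a b a' b' f g : 0 < word_freq f -> 0 < word_freq g ->
  inner (word_pair a b f) (word_pair a' b' g)
  = (a^* * a' + b^* * b') * (if f == g then 2 ^+ word_active f else 0).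
Proof.
move=> f0 g0.
have cross f' g' : 0 < word_freq f' -> 0 < word_freq g' -> (f' == word_adj g') = false.
  move=> f'0 g'0; apply/eqP => e.
  by move: f'0; rewrite e word_freq_adj oppr_gt0 ltNge ltW.
rewrite /word_pair innerDl !innerDr !innerZl !innerZr !word_orthogonal.
rewrite cross // [word_adj f == g]eq_sym cross // (inj_eq (inv_inj (@word_adjK N))).
by rewrite word_active_adj !mulr0 addr0 add0r !mulrA mulrDl.
Qed.

Lemma commutant_sum (I : Type) (r : seq I) (Q : pred I) (a : I -> C) (F : I -> op) :
  (forall i, Q i -> commutant (F i)) ->
  commutant (\sum_(i <- r | Q i) a i *: F i).
Proof.
move=> FQ; rewrite /commutant /= /commutator mulr_sumr mulr_suml -sumrB.
rewrite big1 // => i Qi; have := FQ i Qi; rewrite /commutant /= /commutator => FG.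
by rewrite -!mulmxE -scalemxAr -scalemxAl -scalerBr [X in _ *: X]FG scaler0.
Qed.

Lemma commutantB A B : commutant A -> commutant B -> commutant (A - B).
Proof.
rewrite /commutant /= /commutator => /subr0_eq AG /subr0_eq BG.
by rewrite mulrBr mulrBl AG BG subrr.
Qed.

Lemma commutant_word f : word_freq f = 0 -> commutant (word_op R f).
Proof.
by move=> f0; rewrite /commutant /= commutator_word f0 mulr0 oppr0 scale0r.
Qed.

(** Cyclicity of the trace makes the commutator with a Hermitian A a self-adjoint map. *)
Lemma inner_commutator (A B D : op) : A \is hermsymmx ->
  inner B (commutator A D) = inner (commutator A B) D.
Proof.
move=> /is_hermitianmxP; rewrite expr0 scale1r => Aherm.
rewrite /inner /commutator; congr (_ * _).
rewrite linearB /= map_mxB -!mulmxE !trmx_mul !map_mxM -Aherm.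
rewrite mulmxBr mulmxBl [LHS]raddfB [RHS]raddfB /= !mulmxA; congr (_ - _).
by rewrite [RHS]mxtrace_mulC mulmxA [RHS]mxtrace_mulC mulmxA.
Qed.

(** Both are eigenvectors of the self-adjoint map [G, .], for the distinct eigenvalues 0 and -2
    omega(f). *)
Lemma commutant_orthogonal B f : commutant B -> word_freq f != 0 ->
  inner B (word_op R f) = 0.
Proof.
move=> BG f0; have := inner_commutator B (word_op R f) (G_hermitian R N).
rewrite commutator_word innerZr [commutator _ B]BG -(scale0r B) innerZl conjC0 mul0r.
move/eqP; rewrite mulf_eq0 oppr_eq0 mulf_eq0 pnatr_eq0 intr_eq0 /=.
by rewrite (negPf f0) => /eqP.
Qed.

Lemma Pi0_word A :
  Pi0 A = \sum_(f | word_freq f == 0) word_coef A f *: word_op R f.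
Proof.
set P := \sum_(f | _) _.
have VP : commutant P by apply: commutant_sum => f /eqP; exact: commutant_word.
have orthP B : commutant B -> inner B (A - P) = 0.
  move=> VB; rewrite {1}(word_expansion A) (bigID (fun f => word_freq f == 0)) /=.
  rewrite -/P addrAC subrr add0r inner_sumr big1 // => f f0.
  by rewrite innerZr commutant_orthogonal // mulr0.
(* P meets the specification, so the default 0 of [xget] is excluded; the chosen Q equals P because
   Q - P lies in the commutant and is orthogonal to it. *)
rewrite /Pi0 /orth_proj; case: xgetP => [Q _ [VQ orthQ]|/(_ P)]; last by case.
apply/eqP; rewrite -subr_eq0; apply/eqP/inner_def.
have VQP := commutantB VQ VP.
have {2}-> : Q - P = (A - P) + (-1) *: (A - Q).
  by rewrite scaleN1r opprB [RHS]addrC addrA subrK.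
by rewrite innerDr innerZr orthP // orthQ // mulr0 addr0.
Qed.

Lemma evol_word f (x : R) :
  (evol N x) ^t* * word_op R f * evol N x
  = cis (- ((word_freq f)%:~R * x)) *: word_op R f.
Proof.
apply: Heisenberg_eigenvector; first exact: G_hermitian.
by rewrite commutator_word rmorph_int.
Qed.

Lemma expect_word rho O (x : R) : rho \is hermsymmx ->
  expect rho O x = \sum_f word_coef O f * cis (- ((word_freq f)%:~R * x)) *
    (2 ^+ N * inner rho (word_op R f)).
Proof.
move=> rho_herm; rewrite /expect {1}(word_expansion O) mulr_sumr mulr_suml mulr_sumr.
rewrite raddf_sum; apply: eq_bigr => f _ /=.
rewrite -!mulmxE -scalemxAr -scalemxAl !mulmxE evol_word scalerA.
by rewrite mxtrace_inner // innerZr mulrCA.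
Qed.

(** Moves O to the left slot, as in [fcomp], at the price of exchanging a word with its adjoint. *)
Lemma inner_hermitian A O : O \is hermsymmx -> inner A O = inner O (A ^t* ).
Proof.
move=> /is_hermitianmxP; rewrite expr0 scale1r => O_herm.
by rewrite /inner -O_herm -!mulmxE mxtrace_mulC.
Qed.

Lemma inner_word_pair_r A a b f : inner A (word_pair a b f)
  = a * inner A (word_op R f) + b * inner A (word_op R (word_adj f)).
Proof. by rewrite innerDr !innerZr. Qed.

(** The rotation is diagonal in the basis of the word and its adjoint, with the conjugate phases
    e^{-iwx} and e^{iwx}. *)
Lemma fcomp_word rho O w k (x : R) : O \is hermsymmx -> is_config k ->
    word_freq (config_word k) = w%:Z ->
  let F f := word_coef O f * cis (- ((word_freq f)%:~R * x)) *
    (2 ^+ N * inner rho (word_op R f)) in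
  fcomp rho O w k x = F (config_word k) + F (word_adj (config_word k)).
Proof.
move=> O_herm hk fw F; set f := config_word k in fw *.
rewrite /fcomp Xpair_word // Ypair_word // -/f !inner_word_pair_r.
rewrite /F /word_coef word_active_adj word_freq_adj fw !(inner_hermitian _ O_herm).
rewrite !word_op_adj word_adjK active_config_word //.
rewrite !mxE !big_ord_recl !big_ord0 !mxE !big_ord_recl !big_ord0 !mxE /=.
rewrite !addr0 -/f mulrNz !mulNr opprK -pmulrn.
rewrite /cis cosN sinN (rmorphN (real_complex R)) /=.
have two_neq0 : 2 != 0 :> C by rewrite pnatr_eq0.
(* The exponent may be -1, so it is split in integer powers; the remaining half is then cleared,
   leaving a polynomial identity modulo i^2 = -1. *)
have -> : exprz (2 : C) (N%:Z - (active k)%:Z - 1) = 2 ^+ N * 2 ^- active k / 2.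
  by rewrite !expfzDr // -exprnN exprN1.
move: (inner rho _) (inner rho _) (inner O _) (inner O _) => p q u v.
move: (real_complex R (cos _)) (real_complex R (sin _)) (2 ^+ N) (2 ^- _).
move=> co si a b; apply: (mulIf two_neq0).
have := @sqrCi C; rewrite expr2 => ii.
rewrite [LHS]mulrAC divfK //.

by ring: ii.
Qed.

End Pairs.

Theorem proposition3 (R : realType) (N : nat) (N_ge1 : (1 <= N)%N)
    (c : forall w : nat, 'I_(nconf N w) -> triple N) (c_enum : enumerates c) :
  let X := fun (w : nat) (r : 'I_(nconf N w)) => Xpair R (c w r) in
  let Y := fun (w : nat) (r : 'I_(nconf N w)) => Ypair R (c w r) in
  let m := fun (w : nat) (r : 'I_(nconf N w)) => active (c w r) in
  [/\ (forall (w w' : nat) (r : 'I_(nconf N w)) (r' : 'I_(nconf N w')),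
         (1 <= w <= N)%N -> (1 <= w' <= N)%N ->
         [/\ inner (X w r) (Y w' r') = 0,
             inner (Y w r) (X w' r') = 0
           & existT (fun v => 'I_(nconf N v)) w r <>
               existT (fun v => 'I_(nconf N v)) w' r' ->
             inner (X w r) (X w' r') = 0 /\ inner (Y w r) (Y w' r') = 0]),
      (forall (w : nat) (r : 'I_(nconf N w)), (1 <= w <= N)%N ->
         inner (X w r) (X w r) = 2 ^+ (m w r + 1) /\
         inner (Y w r) (Y w r) = 2 ^+ (m w r + 1)),
      (forall A : op R N,
         exists B : op R N, exists a b : forall w : nat, 'I_(nconf N w) -> R[i],
           commutant B /\
           A = B + \sum_(1 <= w < N.+1) \sum_(r < nconf N w)
                     (a w r *: X w r + b w r *: Y w r))
    & (forall rho O : op R N, is_state rho -> is_observable O ->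
       forall x : R,
         expect rho O x =
           \tr (rho * Pi0 O)
           + \sum_(1 <= w < N.+1) \sum_(r < nconf N w) fcomp rho O w (c w r) x)].
Proof.
have config w r (wN : (1 <= w <= N)%N) := enumerates_is_config c_enum r wN.
have freq_gt0 w r : (1 <= w <= N)%N -> 0 < word_freq (config_word (c w r)).
  by move=> wN; rewrite (enumerates_freq c_enum) // ltz_nat; case/andP: wN.
have range w : (1 <= w < N.+1)%N -> (1 <= w <= N)%N by [].
move=> X Y m; split=> [w w' r r' wN w'N|w r wN|A|rho O [[rho_herm _] _] O_herm x].
- rewrite /X /Y !Xpair_word ?Ypair_word ?config //.
  rewrite !inner_word_pair ?freq_gt0 //; split.
  + by rewrite rmorph1 !mul1r addNr mul0r.
  + by rewrite rmorphN /= conjCi !mulr1 opprK subrr mul0r.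
  (* Equal words would force equal indices. *)
  move=> rr'; case: eqVneq => [/(enumerates_inj c_enum wN w'N)/rr' []|_].
  by rewrite !mulr0.
- rewrite /X /Y /m Xpair_word ?Ypair_word ?config //.
  rewrite !inner_word_pair ?freq_gt0 // eqxx active_config_word ?config //.
  (* Both coefficient vectors have squared length 2, which is the additional factor in 2^(m + 1). *)
  rewrite rmorphN /= conjCi opprK mulrN mulNr -expr2 sqrCi opprK rmorph1 mulr1.
  by rewrite -mulr2n addn1 exprS.
- pose a := word_coef A.
  (* The commutant part collects the words of frequency 0; the other witnesses are the coefficients
     of [word_pair_decomp]. *)
  exists (\sum_(f | word_freq f == 0) a f *: word_op R f).
  exists (fun w r => let f := config_word (c w r) in (a f + a (word_adj f)) / 2).
  exists (fun w r => let f := config_word (c w r) in 'i * (a f - a (word_adj f)) / 2).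
  split; first by apply: commutant_sum => f /eqP; exact: commutant_word.
  rewrite {1}(word_expansion A) sum_words_by_freq; congr (_ + _).
  apply: eq_big_nat => w /range wN; rewrite -(sum_enumerates c_enum _ wN).
  apply: eq_bigr => r _; rewrite /X /Y Xpair_word ?Ypair_word ?config //.
  exact: word_pair_decomp.
rewrite expect_word // sum_words_by_freq; congr (_ + _).
  (* At frequency 0 the phase is [cis 0] = 1, which leaves the constant term. *)
  rewrite Pi0_word mulr_sumr raddf_sum; apply: eq_bigr => f /eqP f0 /=.
  rewrite f0 mul0r oppr0 mxtrace_inner // innerZr /cis cos0 sin0 mulr0 addr0 mulr1.
  by rewrite mulrCA.
apply: eq_big_nat => w /range wN; rewrite -(sum_enumerates c_enum _ wN).
apply: eq_bigr => r _.
by rewrite (fcomp_word _ _ O_herm) ?config ?(enumerates_freq c_enum).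
Qed.
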